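(* Let $A_1, \dots, A_n \in \mathbb{P}_m$, let $\omega = (w_1, \dots, w_n) \in \Delta_n$, and let $\Omega(\omega; A_1, \dots, A_n)$ be the Wasserstein mean. Then $$\det \Omega(\omega; A_1, \dots, A_n) \geq \prod_{j=1}^{n} (\det A_j)^{w_j},$$ where equality holds if and only if $A_1 = \cdots = A_n$.
   Context: $\mathbb{P}_m$ is the set of all $m \times m$ complex positive definite Hermitian matrices. $\Delta_n$ is the set of positive probability vectors $\omega = (w_1, \dots, w_n) \in \mathbb{R}^n$, i.e. $w_j > 0$ for all $j$ and $\sum_{j=1}^n w_j = 1$. The Wasserstein metric on $\mathbb{P}_m$ is $$d(A,B) = \left[ \operatorname{tr}\left( \frac{A+B}{2} \right) - \operatorname{tr} (A^{1/2} B A^{1/2})^{1/2} \right]^{1/2}.$$ The Wasserstein mean is the unique minimizer $$\Omega(\omega; A_1, \dots, A_n) = \underset{X \in \mathbb{P}_m}{\arg\min} \sum_{j=1}^n w_j d^2(X, A_j);$$ it is known to exist, to be unique, and to coincide with the unique solution $X \in \mathbb{P}_m$ of $X = \sum_{j=1}^n w_j (X^{1/2} A_j X^{1/2})^{1/2}$, equivalently of $I = \sum_{j=1}^n w_j (A_j \# X^{-1})$, where $A \# B = A^{1/2}(A^{-1/2} B A^{-1/2})^{1/2} A^{1/2}$. *)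

(* Defs.v *)
From HB Require Import structures.
From mathcomp Require Import all_boot all_order all_algebra.
From mathcomp Require Import spectral sesquilinear.
From mathcomp Require Import all_reals all_analysis.
From mathcomp.real_closed Require Import complex.

Set Implicit Arguments.
Unset Strict Implicit.
Unset Printing Implicit Defensive.

Import Order.TTheory GRing.Theory Num.Theory.
Local Open Scope ring_scope.
Local Open Scope sesquilinear_scope.
Local Open Scope complex_scope.

Definition posdefmx (C : numClosedFieldType) (m : nat) (A : 'M[C]_m) : Prop :=
  A \is hermsymmx /\
  forall u : 'cV[C]_m, u != 0 -> 0 < (u ^t* *m A *m u) 0 0.

Definition possemidefmx (C : numClosedFieldType) (m : nat) (A : 'M[C]_m) :
    Prop :=
  A \is hermsymmx /\
  forall u : 'cV[C]_m, 0 <= (u ^t* *m A *m u) 0 0.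

(* Functional calculus: if A = U^-1 diag(lambda) U with U unitary, then
   A^(1/2) = U^-1 diag(sqrt lambda) U.  Only meaningful for positive
   semidefinite A, see sqrtmx_possemidef and sqrtmxK below. *)
Definition sqrtmx (C : numClosedFieldType) (m : nat) (A : 'M[C]_m) : 'M[C]_m :=
  invmx (spectralmx A) *m diag_mx (map_mx sqrtC (spectral_diag A))
    *m spectralmx A.

Lemma posdefmxW (C : numClosedFieldType) (m : nat) (A : 'M[C]_m) :
  posdefmx A -> possemidefmx A.
Proof.
move=> [hA pA]; split=> // u; have [->|/pA/ltW//] := eqVneq u 0.
by rewrite mulmx0 mxE.
Qed.

Lemma hermsym_spectralE (C : numClosedFieldType) (m : nat) (A : 'M[C]_m) :
  A \is hermsymmx ->
  A = invmx (spectralmx A) *m diag_mx (spectral_diag A) *m spectralmx A.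
Proof. by move=> /hermitian_normalmx /orthomx_spectralP. Qed.

Lemma possemidef_spectral_diag_ge0 (C : numClosedFieldType) (m : nat)
    (A : 'M[C]_m) (i : 'I_m) :
  possemidefmx A -> 0 <= spectral_diag A 0 i.
Proof.
move=> [hA pA]; have UU := spectral_unitarymx A; set U := spectralmx A in UU *.
have := pA (U ^t* *m delta_mx i 0).
rewrite {1}(hermsym_spectralE hA) -/U invmx_unitary // trmx_mul map_mxM trmxCK.
rewrite !mulmxA (mulmxtVK _ UU) -!mulmxA [U *m (U ^t* *m _)]mulmxA.
rewrite (unitarymxP UU) mul1mx trmx_delta map_delta_mx !mulmxA -rowE.
by rewrite -colE !mxE eqxx mulr1n.
Qed.

Lemma sqrtmxK (C : numClosedFieldType) (m : nat) (A : 'M[C]_m) :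
  possemidefmx A -> sqrtmx A *m sqrtmx A = A.
Proof.
move=> [hA _]; rewrite [RHS](hermsym_spectralE hA) /sqrtmx.
set U := spectralmx A; have uU : U \in unitmx := spectral_unit A.
rewrite !mulmxA mulmxK //; congr (_ *m _); rewrite -mulmxA; congr (_ *m _).
rewrite mulmx_diag; congr diag_mx; apply/rowP=> j.
by rewrite !mxE -expr2 sqrtCK.
Qed.

Lemma sqrtmx_possemidef (C : numClosedFieldType) (m : nat) (A : 'M[C]_m) :
  possemidefmx A -> possemidefmx (sqrtmx A).
Proof.
move=> pA; rewrite /sqrtmx (invmx_unitary (spectral_unitarymx A)).
set U := spectralmx A; set D := map_mx sqrtC _.
have D_ge0 i : 0 <= D 0 i.
  by rewrite mxE sqrtC_ge0 possemidef_spectral_diag_ge0.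
split=> [|u].
  apply/is_hermitianmxP; rewrite expr0 scale1r !trmx_mul !map_mxM trmxCK.
  rewrite mulmxA tr_diag_mx; congr (_ *m _ *m _).
  apply/matrixP=> i j; rewrite !mxE rmorphMn /=; congr (_ *+ _).
  by have /CrealP := ger0_real (D_ge0 i); rewrite !mxE => ->.
set v := U *m u.
have -> : u ^t* *m (U ^t* *m diag_mx D *m U) *m u = v ^t* *m diag_mx D *m v.
  by rewrite /v trmx_mul map_mxM !mulmxA.
move: v D D_ge0 => v D D_ge0; rewrite mxE; apply: sumr_ge0 => i _.
by rewrite mul_mx_diag !mxE mulrAC -normCKC mulr_ge0 ?exprn_ge0.
Qed.

Definition positive_probability_vector (R : realType) (n : nat)
    (w : 'I_n -> R) : Prop :=
  (forall j, 0 < w j) /\ \sum_(j < n) w j = 1.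

(* complex.Re : R[i] -> R.  On positive definite A and B the trace expression
   is a nonnegative real. *)
Definition wasserstein_dist (R : realType) (m : nat) (A B : 'M[R[i]]_m) : R :=
  Num.sqrt (complex.Re
    (\tr (2^-1 *: (A + B)) - \tr (sqrtmx (sqrtmx A *m B *m sqrtmx A)))).

Definition wasserstein_objective (R : realType) (m n : nat) (w : 'I_n -> R)
    (A : 'I_n -> 'M[R[i]]_m) (X : 'M[R[i]]_m) : R :=
  \sum_(j < n) w j * wasserstein_dist X (A j) ^+ 2.

(* X is an arg min over the positive definite matrices; for positive definite
   A j and a positive probability vector w such an X exists and is unique. *)
Definition is_wasserstein_mean (R : realType) (m n : nat) (w : 'I_n -> R)
    (A : 'I_n -> 'M[R[i]]_m) (X : 'M[R[i]]_m) : Prop :=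
  posdefmx X /\
  forall Y : 'M[R[i]]_m, posdefmx Y ->
    wasserstein_objective w A X <= wasserstein_objective w A Y.

(* Main.v *)
Require Import Defs.
From mathcomp Require Import all_boot all_order all_algebra.
From mathcomp Require Import spectral sesquilinear.
From mathcomp Require Import all_reals all_analysis.
From mathcomp.real_closed Require Import complex.
From mathcomp Require Import ring lra.

(* For the transport map G_j = A_j # Omega^-1, i.e. the positive definite
   solution of G_j Omega G_j = A_j, the fidelity is tr(G_j Omega).  Replacing
   Omega by G Omega G with G = sum_j w_j G_j lowers the objective by at least
   tr((1-G) Omega (1-G)) / 2, so minimality forces G = 1, without any matrix
   differentiation.  Averaging ln det G_j <= tr G_j - m then gives
   sum_j w_j ln det G_j <= 0, with equality only if every G_j = 1; since
   det A_j = (det G_j)^2 det Omega, this is the claim. *)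

Set Implicit Arguments.
Unset Strict Implicit.
Unset Printing Implicit Defensive.

Import Order.TTheory GRing.Theory Num.Theory.
Local Open Scope ring_scope.
Local Open Scope sesquilinear_scope.
Local Open Scope complex_scope.

(** * Spectral and trace facts for positive definite matrices *)

Section PositiveDefinite.
Variables (C : numClosedFieldType) (m : nat).
Implicit Types (A B X G : 'M[C]_m).

Lemma hermsymmx_trC A : (A \is hermsymmx) <-> (A ^t* = A).
Proof.
by split=> [/is_hermitianmxP|] hA; [|apply/is_hermitianmxP];
  rewrite expr0 scale1r in hA *.
Qed.

(** Through the square root [S] the form is the squared norm of [S u], which vanishes only at
    [u = 0] because [S] inherits invertibility from [A]. *)
Lemma possemidef_unit_posdef A : possemidefmx A -> A \in unitmx -> posdefmx A.
Proof.
move=> pA uA; have [hS _] := sqrtmx_possemidef pA; have AE := sqrtmxK pA.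
case: (pA) => hA _; split=> // u; apply: contraNT => ngt0.
set S := sqrtmx A in hS AE.
have SE : S ^t* = S by apply/hermsymmx_trC.
have uS : S \in unitmx.
  by move: uA; rewrite -AE unitmx_mul => /andP[].
have E : (u ^t* *m A *m u) 0 0 = \sum_i `|(S *m u) i 0| ^+ 2.
  have -> : u ^t* *m A *m u = (S *m u) ^t* *m (S *m u).
    by rewrite -AE trmx_mul map_mxM SE !mulmxA.
  by rewrite mxE; apply: eq_bigr => i _; rewrite !mxE normCKC.
have sum0 : \sum_i `|(S *m u) i 0| ^+ 2 = 0.
  apply/eqP; rewrite eq_le sumr_ge0 => [|i _]; last exact: exprn_ge0.
  rewrite andbT -E; apply: contraNT ngt0 => nle0.
  rewrite lt_def E sumr_ge0 => [|i _]; last exact: exprn_ge0.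
  by rewrite andbT; apply: contraNneq nle0 => /eqP; rewrite E => /eqP->.
have : S *m u = 0.
  apply/colP => i; rewrite [RHS]mxE; apply/eqP.
  rewrite -normr_eq0 -sqrf_eq0; apply/eqP.
  by apply: psumr_eq0P sum0 i isT => i _; apply: exprn_ge0.
by move=> /(canRL (mulKmx uS)); rewrite mulmx0 => ->; rewrite eqxx.
Qed.

(** The form takes the eigenvalue as its value at the unit eigenvector [U ^t* *m delta_mx i 0]. *)
Lemma posdef_spectral_diag_gt0 A i : posdefmx A -> 0 < spectral_diag A 0 i.
Proof.
move=> [hA pA]; have UU := spectral_unitarymx A; set U := spectralmx A in UU *.
have := pA (U ^t* *m delta_mx i 0).
have -> : U ^t* *m delta_mx i 0 != 0 :> 'cV_m.
  apply/eqP => /(congr1 (mulmx U)).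
  rewrite mulmxA (unitarymxP UU) mul1mx mulmx0 => /matrixP/(_ i 0)/eqP.
  by rewrite !mxE !eqxx oner_eq0.
move=> /(_ isT).
rewrite {1}(hermsym_spectralE hA) -/U invmx_unitary // trmx_mul map_mxM trmxCK.
rewrite !mulmxA (mulmxtVK _ UU) -!mulmxA [U *m (U ^t* *m _)]mulmxA.
rewrite (unitarymxP UU) mul1mx trmx_delta map_delta_mx !mulmxA -rowE.
by rewrite -colE !mxE eqxx mulr1n.
Qed.

Lemma det_hermsym A : A \is hermsymmx -> \det A = \prod_i spectral_diag A 0 i.
Proof.
move=> hA; rewrite {1}(hermsym_spectralE hA) !det_mulmx det_inv det_diag.
by rewrite mulrC mulVKr // -unitmxE spectral_unit.
Qed.

Lemma tr_hermsym A : A \is hermsymmx -> \tr A = \sum_i spectral_diag A 0 i.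
Proof.
move=> hA; rewrite {1}(hermsym_spectralE hA) mxtrace_mulC mulmxA.
by rewrite mulmxV ?spectral_unit // mul1mx mxtrace_diag.
Qed.

Lemma mxtraceB A B : \tr (A - B) = \tr A - \tr B.
Proof. exact: linearB. Qed.

Lemma mxtrace_sumZ n (c : 'I_n -> C) (A : 'I_n -> 'M[C]_m) :
  \tr (\sum_j c j *: A j) = \sum_j c j * \tr (A j).
Proof. by rewrite linear_sum; apply: eq_bigr => j _; rewrite linearZ. Qed.

Lemma posdef_det_gt0 A : posdefmx A -> 0 < \det A.
Proof.
move=> pA; case: (pA) => hA _; rewrite (det_hermsym hA).
by apply: prodr_gt0 => i _; apply: posdef_spectral_diag_gt0.
Qed.

Lemma posdef_tr_ge0 A : posdefmx A -> 0 <= \tr A.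
Proof.
move=> pA; case: (pA) => hA _; rewrite (tr_hermsym hA).
by apply: sumr_ge0 => i _; apply/ltW/posdef_spectral_diag_gt0.
Qed.

Lemma posdef_unit A : posdefmx A -> A \in unitmx.
Proof. by move=> /posdef_det_gt0 dA; rewrite unitmxE unitfE gt_eqF. Qed.

Lemma posdef_conj A (T : 'M[C]_m) :
  posdefmx A -> T \in unitmx -> posdefmx (T ^t* *m A *m T).
Proof.
move=> [/hermsymmx_trC hA pA] uT; split=> [|u u_neq0].
  by apply/hermsymmx_trC; rewrite !trmx_mul !map_mxM trmxCK hA mulmxA.
have -> : u ^t* *m (T ^t* *m A *m T) *m u = (T *m u) ^t* *m A *m (T *m u).
  by rewrite trmx_mul map_mxM !mulmxA.
apply: pA; apply: contraNneq u_neq0 => /(canRL (mulKmx uT)).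
by rewrite mulmx0 => ->.
Qed.

Lemma posdef_sqrtmx A : posdefmx A -> posdefmx (sqrtmx A).
Proof.
move=> pA; apply: possemidef_unit_posdef.
  exact/sqrtmx_possemidef/posdefmxW.
have := posdef_unit pA; rewrite -{1}(sqrtmxK (posdefmxW pA)).
by rewrite unitmx_mul => /andP[].
Qed.

Lemma posdef_hermE A : posdefmx A -> A ^t* = A.
Proof. by case=> /hermsymmx_trC. Qed.

Lemma trmxC_inv (A : 'M[C]_m) : (invmx A) ^t* = invmx (A ^t*).
Proof. by rewrite trmx_inv map_invmx. Qed.

Lemma conj_diagE p A (Z : 'M[C]_(m, p)) i :
  (Z ^t* *m A *m Z) i i = ((col i Z) ^t* *m A *m col i Z) 0 0.
Proof. by rewrite tr_col map_row -!row_mul colE mulmxA -colE !mxE. Qed.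

Lemma tr_conj_ge0 p A (Z : 'M[C]_(m, p)) :
  possemidefmx A -> 0 <= \tr (Z ^t* *m A *m Z).
Proof. by move=> [_ pA]; apply: sumr_ge0 => i _; rewrite conj_diagE. Qed.

(** The trace sums the form of [A] over the columns of [Z]; nonnegative terms with sum at most zero
    all vanish, and definiteness then kills each column. *)
Lemma tr_conj_eq0 p A (Z : 'M[C]_(m, p)) :
  posdefmx A -> \tr (Z ^t* *m A *m Z) <= 0 -> Z = 0.
Proof.
move=> pA Z_le0; have psdA := posdefmxW pA.
have /eqP tr0 : \tr (Z ^t* *m A *m Z) == 0 by rewrite eq_le Z_le0 tr_conj_ge0.
suff col0 i : col i Z = 0.
  by apply/matrixP => k i; have /colP/(_ k) := col0 i; rewrite !mxE.
apply/eqP; apply: contraT => /(proj2 pA); rewrite -conj_diagE.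
have -> : (Z ^t* *m A *m Z) i i = 0; last by rewrite ltxx.
by apply: psumr_eq0P tr0 i isT => j _; rewrite conj_diagE; case: psdA.
Qed.

(** * Fidelity and transport maps *)

Definition fidelity A B : C := \tr (sqrtmx (sqrtmx A *m B *m sqrtmx A)).

(* The geometric mean [B # A^-1]: the positive definite solution [G] of
   [G A G = B]. *)
Definition transportmx A B : 'M[C]_m :=
  let S := sqrtmx A in
  invmx S *m sqrtmx (S *m B *m S) *m invmx S.

Lemma posdef_sqrt_conj A B :
  posdefmx A -> posdefmx B -> posdefmx (sqrtmx A *m B *m sqrtmx A).
Proof.
move=> /posdef_sqrtmx pS pB; rewrite -{1}(posdef_hermE pS).
by apply: posdef_conj => //; apply: posdef_unit.
Qed.

Lemma posdef_transportmx A B :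
  posdefmx A -> posdefmx B -> posdefmx (transportmx A B).
Proof.
move=> pA pB; have pS := posdef_sqrtmx pA; have uS := posdef_unit pS.
have iSE : (invmx (sqrtmx A)) ^t* = invmx (sqrtmx A).
  by rewrite trmxC_inv posdef_hermE.
rewrite /transportmx -{1}iSE; apply: posdef_conj; last by rewrite unitmx_inv.
exact/posdef_sqrtmx/posdef_sqrt_conj.
Qed.

(** With [A = S S] the inner factors cancel to [S^-1 Q Q S^-1], and [Q Q = S B S]. *)
Lemma transportmxK A B : posdefmx A -> posdefmx B ->
  transportmx A B *m A *m transportmx A B = B.
Proof.
move=> pA pB; have uS := posdef_unit (posdef_sqrtmx pA).
have QK := sqrtmxK (posdefmxW (posdef_sqrt_conj pA pB)).
have SK := sqrtmxK (posdefmxW pA); rewrite /transportmx.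
set S := sqrtmx A in uS QK SK *; set Q := sqrtmx _ in QK *.
clearbody S Q; rewrite -SK !mulmxA (mulmxKV uS) (mulmxK uS) -(mulmxA _ Q Q) QK.
by rewrite !mulmxA mulVmx // mul1mx mulmxK.
Qed.

Lemma det_transportmx A B : posdefmx A -> posdefmx B ->
  \det B = \det (transportmx A B) * \det A * \det (transportmx A B).
Proof. by move=> pA pB; rewrite -!det_mulmx transportmxK. Qed.

(** Writing [A = S S], the product [S^-1 Q S^-1 S S] reduces to [S^-1 Q S], a conjugate of [Q]. *)
Lemma fidelityE A B : posdefmx A -> posdefmx B ->
  fidelity A B = \tr (transportmx A B *m A).
Proof.
move=> pA pB; have uS := posdef_unit (posdef_sqrtmx pA).
have SK := sqrtmxK (posdefmxW pA); rewrite /fidelity /transportmx.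
move: (sqrtmx A) uS SK => S uS SK; rewrite -SK mulmxA mulmxKV //.
by rewrite [RHS]mxtrace_mulC mulmxA mulmxV ?mul1mx.
Qed.

(* Expand [0 <= tr (Z^* G Z)] with [G] the transport map and
   [Z = M - G^-1 N]. *)
Lemma fidelity_lb (M N : 'M[C]_m) A B : posdefmx A -> posdefmx B ->
    A = M *m M ^t* -> B = N *m N ^t* ->
  \tr (M ^t* *m N) + \tr (N ^t* *m M) <= 2 * fidelity A B.
Proof.
move=> pA pB AE BE; have pG := posdef_transportmx pA pB.
have GK := transportmxK pA pB; rewrite fidelityE //.
move: (transportmx A B) pG GK => G pG GK.
have uG := posdef_unit pG; have hG := posdef_hermE pG.
have := tr_conj_ge0 (M - invmx G *m N) (posdefmxW pG).
have -> : (M - invmx G *m N) ^t* = M ^t* - N ^t* *m invmx G.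
  by rewrite linearB /= map_mxB trmx_mul map_mxM trmxC_inv hG.
rewrite mulmxBl (mulmxKV uG) mulmxBl !mulmxBr !mxtraceB.
have -> : M ^t* *m G *m (invmx G *m N) = M ^t* *m N by rewrite mulmxA mulmxK.
have -> : \tr (M ^t* *m G *m M) = \tr (G *m A).
  by rewrite AE -mulmxA [LHS]mxtrace_mulC -mulmxA.
(* After cycling, [N *m N ^t*] is [B = G A G], so [G^-1 B] collapses to [A G]. *)
have -> : \tr (N ^t* *m (invmx G *m N)) = \tr (G *m A).
  by rewrite mxtrace_mulC -mulmxA -BE -GK -!mulmxA mulKmx // [LHS]mxtrace_mulC.
move=> ge0; rewrite -subr_ge0.
suff <- : \tr (G *m A) - \tr (M ^t* *m N) - (\tr (N ^t* *m M) - \tr (G *m A))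
    = 2 * \tr (G *m A) - (\tr (M ^t* *m N) + \tr (N ^t* *m M)) by [].
by ring.
Qed.

(** The fidelity of [T A T] is tested against the transport map starting from [A], not from [T A T].
    The bound is therefore linear in [transportmx A B] and can be averaged over several [B]. *)
Lemma fidelity_conj_lb A B (T : 'M[C]_m) :
    posdefmx A -> posdefmx B -> posdefmx T ->
  \tr (A *m T *m transportmx A B) + \tr (T *m A *m transportmx A B) <=
  2 * fidelity (T *m A *m T) B.
Proof.
move=> pA pB pT; have hT := posdef_hermE pT.
have pTAT : posdefmx (T *m A *m T).
  by rewrite -{1}hT; apply/posdef_conj/posdef_unit.
have hG := posdef_hermE (posdef_transportmx pA pB).
have GK := transportmxK pA pB; have SK := sqrtmxK (posdefmxW pA).
have hS := posdef_hermE (posdef_sqrtmx pA).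
move: (transportmx A B) (sqrtmx A) hG GK SK hS => G S hG GK SK hS.
(* Since [A = S S] and [B = G A G], the factors [T S] and [G S], each multiplied by its adjoint,
   give [T A T] and [B]. *)
have := @fidelity_lb (T *m S) (G *m S) _ _ pTAT pB.
rewrite !trmx_mul !map_mxM hS hG hT.
have -> : \tr (S *m T *m (G *m S)) = \tr (A *m T *m G).
  by rewrite mulmxA mxtrace_mulC -SK !mulmxA.
have -> : \tr (S *m G *m (T *m S)) = \tr (T *m A *m G).
  by rewrite [LHS]mxtrace_mulC -SK !mulmxA.
by apply; rewrite -?GK -SK !mulmxA.
Qed.

(** Put [B = G A G] and expand. The right side is visibly nonnegative, which later makes the square
    root in the distance exact. *)
Lemma wasserstein_gapE A B : posdefmx A -> posdefmx B ->
  \tr (2^-1 *: (A + B)) - fidelity A B =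
  2^-1 * \tr ((1%:M - transportmx A B) ^t* *m A *m (1%:M - transportmx A B)).
Proof.
move=> pA pB; rewrite fidelityE //; have BE := transportmxK pA pB.
have hG := posdef_hermE (posdef_transportmx pA pB).
move: (transportmx A B) hG BE => G hG <-.
have -> : (1%:M - G) ^t* = 1%:M - G.
  by rewrite linearB /= map_mxB hG trmx1 map_mx1.
rewrite mulmxBl mul1mx mulmxBr mulmx1 mulmxBl mxtraceZ !mxtraceB mxtraceD.
by rewrite (mxtrace_mulC A G); field.
Qed.

(** * The averaged transport map at a minimizer *)

Lemma posdef_sum n (c : 'I_n.+1 -> C) (A : 'I_n.+1 -> 'M[C]_m) :
  (forall j, 0 < c j) -> (forall j, posdefmx (A j)) ->
  posdefmx (\sum_j c j *: A j).
Proof.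
move=> c_gt0 pA; split=> [|u u_neq0].
  apply/hermsymmx_trC; rewrite linear_sum map_mx_sum; apply: eq_bigr => j _.
  rewrite linearZ map_mxZ /= (posdef_hermE (pA j)); congr (_ *: _).
  by apply/CrealP/gtr0_real/c_gt0.
have form_gt0 j : 0 < (u ^t* *m (c j *: A j) *m u) 0 0.
  by rewrite -scalemxAr -scalemxAl mxE mulr_gt0 //; apply: (proj2 (pA j)).
(* The head term is strictly positive and the tail nonnegative; the index [n.+1] guarantees a head
   term, an empty sum being zero. *)
rewrite mulmx_sumr mulmx_suml summxE big_ord_recl ltr_wpDr //.
by apply: sumr_ge0 => j _; apply: ltW.
Qed.

(** The Wasserstein objective kept in [C], with no real part and no square root, so that trace
    identities apply directly. *)
Definition trace_objective n (c : 'I_n -> C) (A : 'I_n -> 'M[C]_m) X : C :=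
  \sum_j c j * (\tr (2^-1 *: (X + A j)) - fidelity X (A j)).

(* The competitor [G X G], with [G] the averaged transport map, strictly
   decreases the objective unless [G = 1]. *)
Lemma mean_transport_eq1 n (c : 'I_n.+1 -> C) (A : 'I_n.+1 -> 'M[C]_m) X :
    (forall j, 0 < c j) -> \sum_j c j = 1 ->
    (forall j, posdefmx (A j)) -> posdefmx X ->
    (forall Y, posdefmx Y -> trace_objective c A X <= trace_objective c A Y) ->
  \sum_j c j *: transportmx X (A j) = 1%:M.
Proof.
move=> c_gt0 c_sum1 pA pX X_min.
have pGj j := posdef_transportmx pX (pA j).
have pG := posdef_sum c_gt0 pGj.
have [G GE] : exists G, \sum_j c j *: transportmx X (A j) = G by eexists.
rewrite GE in pG *.
have hG := posdef_hermE pG.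
have pY : posdefmx (G *m X *m G).
  by rewrite -{1}hG; apply/posdef_conj/posdef_unit.
have objE Z : trace_objective c A Z =
    2^-1 * \tr Z + \sum_j c j * (2^-1 * \tr (A j)) - \sum_j c j * fidelity Z (A j).
  have <- : \sum_j c j * (2^-1 * \tr Z) = 2^-1 * \tr Z.
    by rewrite -mulr_suml c_sum1 mul1r.
  rewrite -big_split -sumrB /=; apply: eq_bigr => j _.
  by rewrite linearZ linearD /=; ring.
have two_gt0 : 0 < 2 :> C by rewrite ltr0n.
have fidX : \sum_j c j * fidelity X (A j) = \tr (G *m X).
  rewrite -GE mulmx_suml linear_sum; apply: eq_bigr => j _.
  by rewrite fidelityE // -scalemxAl linearZ.
(* The bound of [fidelity_conj_lb] at [T = G] is linear in each transport map, so the weighted sum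
   replaces that map by [G], and both traces become that of [G X G]. *)
have fidY : \tr (G *m X *m G) <=
    \sum_j c j * fidelity (G *m X *m G) (A j).
  rewrite -(ler_pM2l two_gt0) [leRHS]mulr_sumr.
  have -> : 2 * \tr (G *m X *m G) =
      \sum_j c j * (\tr (X *m G *m transportmx X (A j)) +
                         \tr (G *m X *m transportmx X (A j))).
    have sumE (B : 'M[C]_m) :
        \sum_j c j * \tr (B *m transportmx X (A j)) = \tr (B *m G).
      rewrite -GE mulmx_sumr linear_sum; apply: eq_bigr => j _.
      by rewrite -scalemxAr linearZ.
    under eq_bigr do rewrite mulrDr.
    rewrite big_split !sumE /= [\tr (X *m G *m G)]mxtrace_mulC mulmxA.
    by ring.
  apply: ler_sum => j _; rewrite mulrCA ler_wpM2l //; first exact: ltW.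
  exact: fidelity_conj_lb.
have := X_min _ pY; rewrite !objE fidX -subr_ge0 => le.
suff : 1%:M - G = 0 by move/eqP; rewrite subr_eq0 => /eqP.
apply: (tr_conj_eq0 pX).
have -> : (1%:M - G) ^t* = 1%:M - G.
  by rewrite linearB /= map_mxB hG trmx1 map_mx1.
rewrite mulmxBl mul1mx mulmxBr mulmx1 mulmxBl !mxtraceB (mxtrace_mulC X G).
move: le; set g := \tr (G *m X); set v := \sum_j _ * (_ * _).
move: fidY; set t := \tr _; set u := \sum_j _; rewrite -subr_ge0 => fidY le.
(* The first summand is twice the objective at [G X G] minus that at [X], nonnegative by minimality;
   the second is nonnegative by [fidY]. *)
have -> : \tr X - g - (g - t) =
    - (2 * (2^-1 * t + v - u - (2^-1 * \tr X + v - g)) + 2 * (u - t)).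
  by field.
by rewrite oppr_le0 addr_ge0 // mulr_ge0 // ltW.
Qed.

End PositiveDefinite.

(** * From complex traces to the real-valued objective *)

Section WassersteinMean.
Variables (R : realType) (m : nat).
Implicit Types (X Y G : 'M[R[i]]_m).

Lemma RRe_ge0 (z : R[i]) : 0 <= z -> (complex.Re z)%:C = z.
Proof. by move=> /ger0_real/RRe_real. Qed.

Lemma RRe_gt0 (z : R[i]) : 0 < z -> (complex.Re z)%:C = z.
Proof. by move=> /ltW/RRe_ge0. Qed.

Lemma Re_gt0 (z : R[i]) : 0 < z -> 0 < complex.Re z.
Proof. by move=> z_gt0; rewrite -ltcR RRe_gt0. Qed.

Lemma ReM_gt0 (y z : R[i]) : 0 < y -> 0 < z ->
  complex.Re (y * z) = complex.Re y * complex.Re z.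
Proof.
by move=> y_gt0 z_gt0; rewrite -(RRe_gt0 y_gt0) -(RRe_gt0 z_gt0) -rmorphM.
Qed.

(** The trace expression is a nonnegative real by [wasserstein_gapE], so taking the real part and a
    square root loses nothing. *)
Lemma wasserstein_distE X Y : posdefmx X -> posdefmx Y ->
  (wasserstein_dist X Y ^+ 2)%:C = \tr (2^-1 *: (X + Y)) - fidelity X Y.
Proof.
move=> pX pY.
have gap_ge0 : 0 <= \tr (2^-1 *: (X + Y)) - fidelity X Y.
  rewrite wasserstein_gapE // mulr_ge0 ?invr_ge0 ?ler0n //.
  exact/tr_conj_ge0/posdefmxW.
by rewrite sqr_sqrtr ?RRe_ge0 // -lecR RRe_ge0.
Qed.

Lemma wasserstein_mean_transport n (w : 'I_n -> R) (A : 'I_n -> 'M[R[i]]_m) X :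
    (forall j, posdefmx (A j)) -> positive_probability_vector w ->
    is_wasserstein_mean w A X ->
  \sum_j (w j)%:C *: transportmx X (A j) = 1%:M.
Proof.
case: n w A => [|n] w A pA [w_gt0 w_sum1] [pX X_min].
  (* For [n = 0] the weights would sum to 0 instead of 1. *)
  by move: w_sum1; rewrite big_ord0 => /eqP; rewrite eq_sym oner_eq0.
have objE Y : posdefmx Y -> (wasserstein_objective w A Y)%:C =
      trace_objective (fun j => (w j)%:C) A Y.
  move=> pY; rewrite rmorph_sum; apply: eq_bigr => j _.
  by rewrite rmorphM; congr (_ * _); exact: wasserstein_distE pY (pA j).
apply: (@mean_transport_eq1 _ m n (fun j => (w j)%:C) A X _ _ pA pX).
- by move=> j; rewrite ltcR.
- by rewrite -rmorph_sum w_sum1 rmorph1.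
- by move=> Y pY; rewrite -(objE X pX) -(objE Y pY) lecR; exact: X_min.
Qed.

(** * Logarithm inequalities and the log-determinant gap *)

Lemma ln_le_subr1 (x : R) : 0 < x -> ln x <= x - 1.
Proof.
by move=> x_gt0; rewrite -{1}[x](subrKC 1); apply: le_ln1Dx; lra.
Qed.

(** If [y = x - 1] is nonzero then [1 + y < expR y]; with [y = ln x] this reads [x < x]. *)
Lemma ln_eq_subr1 (x : R) : 0 < x -> ln x = x - 1 -> x = 1.
Proof.
move=> x_gt0 lnx; apply/eqP; rewrite -subr_eq0; apply: contraT.
by move=> /expR_gt1Dx; rewrite -{2}lnx lnK ?posrE // subrKC ltxx.
Qed.

Lemma ln_prod (I : Type) (s : seq I) (x : I -> R) :
  (forall i, 0 < x i) -> ln (\prod_(i <- s) x i) = \sum_(i <- s) ln (x i).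
Proof.
move=> x_gt0; rewrite -[RHS]expRK expR_sum; congr ln.
by apply: eq_bigr => i _; rewrite lnK ?posrE.
Qed.

(** The log-determinant divergence (Stein loss) of [G] from the identity. *)
Definition logdet_gap G : R :=
  complex.Re (\tr G) - m%:R - ln (complex.Re (\det G)).

(** The gap splits over the eigenvalues, which reduces its sign and its zeros to the scalar facts on
    [ln]. *)
Lemma logdet_gapE G (r := fun i => complex.Re (spectral_diag G 0 i)) :
  posdefmx G -> logdet_gap G = \sum_i (r i - 1 - ln (r i)).
Proof.
move=> pG; case: (pG) => hG _.
have r_gt0 i : 0 < r i by apply/Re_gt0/posdef_spectral_diag_gt0.
have rE i : spectral_diag G 0 i = (r i)%:C.
  by rewrite RRe_gt0 //; apply: posdef_spectral_diag_gt0.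
rewrite /logdet_gap tr_hermsym // det_hermsym //.
rewrite (eq_bigr _ (fun i _ => rE i)) [in ln _](eq_bigr _ (fun i _ => rE i)).
by rewrite -rmorph_sum -rmorph_prod /= ln_prod // !sumrB sumr_const card_ord.
Qed.

Lemma logdet_gap_ge0 G : posdefmx G -> 0 <= logdet_gap G.
Proof.
move=> pG; rewrite logdet_gapE //; apply: sumr_ge0 => i _.
by rewrite subr_ge0 ln_le_subr1 //; apply/Re_gt0/posdef_spectral_diag_gt0.
Qed.

Lemma logdet_gap_eq0 G : posdefmx G -> logdet_gap G = 0 -> G = 1%:M.
Proof.
move=> pG; case: (pG) => hG _; rewrite logdet_gapE // => sum0.
have d_gt0 i := posdef_spectral_diag_gt0 i pG.
have d1 i : spectral_diag G 0 i = 1.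
  rewrite -(RRe_gt0 (d_gt0 i)) (_ : complex.Re _ = 1) //.
  apply: ln_eq_subr1; first exact: Re_gt0.
  apply/esym/eqP; rewrite -subr_eq0; apply/eqP.
  apply: psumr_eq0P sum0 i isT => j _.
  by rewrite subr_ge0 ln_le_subr1 // Re_gt0.
rewrite (hermsym_spectralE hG) (_ : spectral_diag G = const_mx 1).
  by rewrite diag_const_mx mulmx1 mulVmx ?spectral_unit.
by apply/rowP => i; rewrite d1 mxE.
Qed.

Lemma logdet_gap1 : logdet_gap 1%:M = 0.
Proof.
rewrite /logdet_gap mxtrace1 det1 -(rmorph_nat (real_complex R)) /=.
by rewrite subrr ln1 subr0.
Qed.

(** The traces of the [G j] average to the trace of the identity, [m], so in the averaged gap they
    cancel and only the logarithms remain. *)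
Lemma sum_ln_det n (w : 'I_n -> R) (G : 'I_n -> 'M[R[i]]_m) :
    \sum_j w j = 1 -> (forall j, posdefmx (G j)) ->
    \sum_j (w j)%:C *: G j = 1%:M ->
  \sum_j w j * ln (complex.Re (\det (G j))) = - \sum_j w j * logdet_gap (G j).
Proof.
move=> w_sum1 pG G1.
have trG : \sum_j w j * complex.Re (\tr (G j)) = m%:R.
  apply: complexI; rewrite rmorph_sum rmorph_nat -mxtrace1 -G1 mxtrace_sumZ.
  apply: eq_bigr => j _; rewrite rmorphM; congr (_ * _).
  exact: RRe_ge0 (posdef_tr_ge0 (pG j)).
under [in RHS]eq_bigr do rewrite mulrBr mulrBr.
by rewrite !sumrB trG -mulr_suml w_sum1 mul1r subrr sub0r opprK.
Qed.

(** * The log-determinant of the mean *)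

Lemma ln_det_transport X Y : posdefmx X -> posdefmx Y ->
  ln (complex.Re (\det Y)) =
  2 * ln (complex.Re (\det (transportmx X Y))) + ln (complex.Re (\det X)).
Proof.
move=> pX pY; have g_gt0 := posdef_det_gt0 (posdef_transportmx pX pY).
have x_gt0 := posdef_det_gt0 pX.
rewrite (det_transportmx pX pY) ReM_gt0 ?ReM_gt0 ?mulr_gt0 //.
by rewrite !lnM ?posrE ?mulr_gt0 ?Re_gt0 //; ring.
Qed.

(** An exact identity rather than an estimate: the weighted gap is the whole defect, so the
    inequality and its equality case are both read off from it. *)
Lemma ln_det_mean n (w : 'I_n -> R) (A : 'I_n -> 'M[R[i]]_m) X :
    (forall j, posdefmx (A j)) -> \sum_j w j = 1 ->
    posdefmx X -> \sum_j (w j)%:C *: transportmx X (A j) = 1%:M ->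
  ln (complex.Re (\det X)) = \sum_j w j * ln (complex.Re (\det (A j))) +
    2 * \sum_j w j * logdet_gap (transportmx X (A j)).
Proof.
move=> pA w_sum1 pX G1.
have := sum_ln_det w_sum1 (fun j => posdef_transportmx pX (pA j)) G1.
move/(congr1 -%R); rewrite opprK => <-; rewrite mulrN.
under [in RHS]eq_bigr do rewrite (ln_det_transport pX (pA _)) mulrDr mulrCA.
by rewrite big_split /= -mulr_sumr -mulr_suml w_sum1; ring.
Qed.

End WassersteinMean.

Theorem theorem3p5 (R : realType) (m n : nat) (w : 'I_n -> R)
    (A : 'I_n -> 'M[R[i]]_m) (Omega : 'M[R[i]]_m)
    (hA : forall j, posdefmx (A j))
    (hw : positive_probability_vector w)
    (hOmega : is_wasserstein_mean w A Omega) :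
  (\prod_(j < n) (complex.Re (\det (A j)) `^ w j))%:C <= \det Omega /\
  (\det Omega = (\prod_(j < n) (complex.Re (\det (A j)) `^ w j))%:C <->
   forall i j, A i = A j).
Proof.
have pX := proj1 hOmega.
have G1 := wasserstein_mean_transport hA hw hOmega.
case: hw => w_gt0 w_sum1; have lnX := ln_det_mean hA w_sum1 pX G1.
set x := complex.Re (\det Omega) in lnX.
set P := \prod_j _; set gap := \sum_j w j * logdet_gap _ in lnX.
have x_gt0 : 0 < x by apply/Re_gt0/posdef_det_gt0.
have xE : \det Omega = x%:C by rewrite RRe_gt0 // posdef_det_gt0.
have powA_gt0 j : 0 < complex.Re (\det (A j)) `^ w j.
  exact: powR_gt0 (Re_gt0 (posdef_det_gt0 (hA j))).
have P_gt0 : 0 < P by apply: prodr_gt0.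
have {}lnX : ln x = ln P + 2 * gap.
  by rewrite lnX /P ln_prod //; under [in RHS]eq_bigr do rewrite ln_powR.
have pG j := posdef_transportmx pX (hA j).
have gap_ge0 j : 0 <= w j * logdet_gap (transportmx Omega (A j)).
  exact: mulr_ge0 (ltW (w_gt0 j)) (logdet_gap_ge0 (pG j)).
rewrite xE lecR -ler_ln ?posrE // lnX; split.
  by rewrite lerDl mulr_ge0 // sumr_ge0.
have -> : (x%:C = P%:C) <-> (gap = 0).
  split=> [/complexI xP|gap0]; first by move: lnX; rewrite xP; lra.
  by congr _%:C; apply: ln_inj; rewrite ?posrE // lnX gap0 mulr0 addr0.
split=> [gap0 | A_const].
  (* A zero sum of nonnegative terms with positive weights makes every transport map [G] the
     identity, and [G Omega G = A j] then gives [A j = Omega]. *)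
  suff AX j : A j = Omega by move=> i j; rewrite !AX.
  rewrite -[LHS](transportmxK pX (hA j)) (logdet_gap_eq0 (pG j)).
    by rewrite mul1mx mulmx1.
  have /eqP : w j * logdet_gap (transportmx Omega (A j)) = 0.
    exact: psumr_eq0P (fun i _ => gap_ge0 i) gap0 j isT.
  by rewrite mulf_eq0 gt_eqF // => /eqP.
apply: big1 => j _; rewrite (_ : transportmx _ _ = 1%:M) ?logdet_gap1 ?mulr0 //.
(* When all [A j] agree, the average in [G1] is the common transport map itself, which is therefore
   the identity. *)
rewrite -G1; under eq_bigr do rewrite (A_const _ j).
by rewrite -scaler_suml -rmorph_sum w_sum1 rmorph1 scale1r.
Qed.
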